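(* Let $(X,\|\cdot\|)$ be a real normed space and let $\sigma$ be a Hausdorff topology on $X$ coarser than the norm topology, such that the closed unit ball $B_X$ is sequentially $\sigma$-compact. Let $K$ be a nonempty $\sigma$-closed subset of $X$. Assume that $\psi: K\times K\to\mathbb{R}$ satisfies condition $(K_\sigma)$ and that $S(\psi,K_n)$ is nonempty and $\sigma$-closed for each $n\in\mathbb{N}$. If $R^E_\sigma\subseteq\{0\}$, then $S(\psi,K)$ is nonempty and $(S(\psi,K))^\infty_\sigma=\{0\}$.
   Context: Notation. $K_n:=\{x\in K:\|x\|\le n\}$ for $n\in\mathbb{N}=\{1,2,\dots\}$. For $A\subseteq K$, $S(\psi,A):=\{\bar x\in A:\psi(\bar x,y)\ge 0\ \ \forall y\in A\}$ is the solution set of the equilibrium problem for $\psi$ on $A$. $x_k\xrightarrow{\sigma}x$ denotes convergence in the topology $\sigma$. Asymptotic cone. For $A\subseteq X$, $A^\infty_\sigma:=\{u\in X:\ \exists\, t_k\to+\infty \text{ and } (x_k)\subseteq A \text{ with } \frac{x_k}{t_k}\xrightarrow{\sigma}u\}$, and $\emptyset^\infty_\sigma=\emptyset$. $\sigma g$-asymptotic function. For a proper function $f:X\to\mathbb{R}\cup\{+\infty\}$ (i.e. not identically $+\infty$), $[f\le\lambda]:=\{x: f(x)\le\lambda\}$ and $f^{\sigma g}:X\to\mathbb{R}\cup\{\pm\infty\}$ is $f^{\sigma g}(u):=\inf\{\lambda\in\mathbb{R}: u\in([f\le\lambda])^\infty_\sigma\}$ (with $\inf\emptyset=+\infty$).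 A function defined only on $K$ is extended by $+\infty$ on $X\setminus K$ before forming $f^{\sigma g}$. The set $R^E_\sigma$. $R^E_\sigma:=\{u\in K^\infty_\sigma: (-\psi(\cdot,y))^{\sigma g}(u)\le 0\ \ \forall y\in K\}$. Condition $(K_\sigma)$. $\psi$ satisfies $(K_\sigma)$ if for any unbounded sequence $(x_n)$ such that $x_n\in S(\psi,K_n)$ for each $n\in\mathbb{N}$, there exist a subsequence $(x_{n_k})$ of $(x_n)$, a sequence $(w_k)\subseteq K$ and $0\neq d\in K^\infty_\sigma$ such that for each $k\in\mathbb{N}$, $\psi(x_{n_k},y)\le\psi(w_k,y)$ for all $y\in K_{n_k}$, and $\frac{w_k}{\|w_k\|}\xrightarrow{\sigma}d$ as $k\to\infty$.
   Formalization: The formal theorem also assumes that for each fixed c > 0 the map x ↦ cx is σ-continuous (true for every vector topology); for an arbitrary Hausdorff topology coarser than the norm topology the statement is false, since compactness of the unit ball does not control larger balls. *)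

(* Defs.v *)
From HB Require Import structures.
From mathcomp Require Import all_boot all_order all_algebra.
From mathcomp Require Import all_classical all_reals all_analysis.

Set Implicit Arguments.
Unset Strict Implicit.
Unset Printing Implicit Defensive.

Import Order.TTheory GRing.Theory Num.Theory.
Import numFieldNormedType.Exports.

Local Open Scope classical_set_scope.
Local Open Scope ring_scope.

(* A second topology on a type that may already carry a canonical one.
   (The empty set is open as the union of an empty family.) *)
Record topology_on (X : choiceType) := TopologyOn {
  open_in : set_system X ;
  open_inT : open_in setT ;
  open_inI : setI_closed open_in ;
  open_in_bigU : forall (I : Type) (f : I -> set X),
    (forall i, open_in (f i)) -> open_in (\bigcup_i f i) }.

(* [with_topology sigma] is X itself, carrying sigma as its canonical topology.
   It is convertible to X, so points and sets of X can be cast to it in order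
   to use the library notions of convergence, closedness, ... for sigma. *)
Definition with_topology (X : choiceType) (sigma : topology_on X) : Type := X.

HB.instance Definition _ (X : choiceType) (sigma : topology_on X) :=
  Choice.on (with_topology sigma).
HB.instance Definition _ (X : choiceType) (sigma : topology_on X) :=
  isOpenTopological.Build (with_topology sigma)
    (open_inT sigma) (@open_inI X sigma) (@open_in_bigU X sigma).

Definition cvg_in (X : choiceType) (sigma : topology_on X)
    (x : nat -> X) (l : X) : Prop :=
  (x : nat -> with_topology sigma) @ \oo --> (l : with_topology sigma).

Definition closed_in (X : choiceType) (sigma : topology_on X) (A : set X) :
    Prop :=
  closed (A : set (with_topology sigma)).

Definition hausdorff_in (X : choiceType) (sigma : topology_on X) : Prop :=
  hausdorff_space (with_topology sigma).

Definition seq_compact_in (X : choiceType) (sigma : topology_on X)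
    (A : set X) : Prop :=
  forall x : nat -> X, (forall n, A (x n)) ->
    exists (phi : nat -> nat) (l : X),
      [/\ {homo phi : i j / (i < j)%N}, A l & cvg_in sigma (x \o phi) l].

Definition coarser_than_norm (R : realType) (X : normedModType R)
    (sigma : topology_on X) : Prop :=
  forall A : set X, open_in sigma A -> open A.

(* Compatibility of sigma with the vector space structure, in the weak form
   of sigma-continuity of x |-> c x for each fixed c > 0; every vector space
   topology satisfies it. It transfers sequential sigma-compactness from the
   unit ball to all closed balls; an arbitrary topology on the set X would
   leave balls of radius greater than 1 unconstrained. *)
Definition scaling_continuous_in (R : realType) (X : normedModType R)
    (sigma : topology_on X) : Prop :=
  forall c : R, 0 < c ->
    continuous ((fun x : X => c *: x) :
      with_topology sigma -> with_topology sigma).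

Section Asymptotic.
Context {R : realType} {X : normedModType R} (sigma : topology_on X).

Definition asymptotic_cone (A : set X) : set X :=
  [set u | exists (t : nat -> R) (x : nat -> X),
    [/\ t @ \oo --> +oo, (forall k, A (x k))
      & cvg_in sigma (fun k => (t k)^-1 *: x k) u]].

Definition sublevel (f : X -> \bar R) (lambda : R) : set X :=
  [set x | (f x <= lambda%:E)%E].

Definition sg_asymptotic (f : X -> \bar R) (u : X) : \bar R :=
  ereal_inf [set lambda%:E | lambda in
    [set lambda : R | asymptotic_cone (sublevel f lambda) u]].

Definition extend_pinfty (K : set X) (f : X -> R) (x : X) : \bar R :=
  if x \in K then (f x)%:E else +oo%E.

(* A bifunction psi : K x K -> R is represented by a total psi : X -> X -> R
   of which only the values on K x K are ever used. *)

Definition equilibria (psi : X -> X -> R) (A : set X) : set X :=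
  [set x | A x /\ forall y, A y -> 0 <= psi x y].

Definition truncation (K : set X) (n : nat) : set X :=
  K `&` [set x | `|x| <= n%:R].

Definition recession_set (K : set X) (psi : X -> X -> R) : set X :=
  [set u | asymptotic_cone K u /\
    forall y, K y ->
      (sg_asymptotic (extend_pinfty K (fun x => (- psi x y)%R)) u <= 0)%E].

(* Here the positive integers index the given sequence x, so that x 0 is
   irrelevant, whereas k ranges over all of nat. The condition w k != 0 is what
   makes the quotient of w k by its norm meaningful. *)
Definition condition_K (K : set X) (psi : X -> X -> R) : Prop :=
  forall x : nat -> X,
    (forall n, (0 < n)%N -> equilibria psi (truncation K n) (x n)) ->
    ~ bounded_set (range x) ->
    exists (phi : nat -> nat) (w : nat -> X) (d : X),
      [/\ {homo phi : i j / (i < j)%N} /\ (forall k, (0 < phi k)%N),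
          (forall k, K (w k) /\ w k != 0),
          asymptotic_cone K d /\ d != 0,
          (forall k y, truncation K (phi k) y -> psi (x (phi k)) y <= psi (w k) y)
        & cvg_in sigma (fun k => `|w k|^-1 *: w k) d].

End Asymptotic.

(* Main.v *)
Require Import Defs.
From mathcomp Require Import all_boot all_order all_algebra.
From mathcomp Require Import all_classical all_reals all_analysis.
Import Order.TTheory GRing.Theory Num.Theory.
Import numFieldNormedType.Exports.
Local Open Scope classical_set_scope.
Local Open Scope ring_scope.

(** The cone equality is immediate from the definition of the recession set:
    a solution x on K satisfies - psi x y <= 0 for every y in K, so a direction
    approached by rescaled solutions lies in the asymptotic cone of every
    sublevel set [- psi(., y) <= 0], hence in the recession set, hence is 0
    (lemma [recession_set_asymptotic]).

    For existence, consider points of K that are nonnegative against every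
    member of K_n as soon as their index is large. If they stay in a fixed
    ball, sequential compactness gives them a sigma-limit point; for each large
    n they eventually lie in the sigma-closed set S(psi, K_n), so the limit
    point solves the problem on all K_n at once, that is, on K (lemma
    [equilibria_of_bounded_approx]).

    Now pick x_n in S(psi, K_n). A bounded sequence is handled by this
    argument. For an unbounded one, condition (K_sigma) provides points w_k that
    are at least as good as x_{n_k} on K_{n_k}, with normalised limit d != 0.
    Nothing in that condition makes w_k unbounded, so there are two cases. If
    the norms of w_k tend to infinity, they serve as scaling factors and d is a
    nonzero element of the recession set, which is excluded. Otherwise
    infinitely many w_k lie in one ball, and the compactness argument applies
    to these w_k instead of the x_n. *)

Section TopologyOnNormedSpace.
Set Implicit Arguments.
Unset Strict Implicit.
Context {R : realType} {X : normedModType R} (sigma : topology_on X).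

(** This lets eventual properties pass to a subsequence. *)
Lemma increasing_cvgny (phi : nat -> nat) :
  {homo phi : i j / (i < j)%N} -> phi @ \oo --> \oo.
Proof.
move=> phi_incr; have phi_ge k : (k <= phi k)%N.
  by elim: k => // k ihk; exact: leq_ltn_trans ihk (phi_incr _ _ (ltnSn k)).
move=> A [N _ NA]; exists N => // k /= Nk.
by apply: NA => /=; exact: leq_trans Nk (phi_ge k).
Qed.

Lemma cvg_in_subseq (x : nat -> X) (l : X) (phi : nat -> nat) :
  phi @ \oo --> \oo -> cvg_in sigma x l -> cvg_in sigma (x \o phi) l.
Proof. exact: cvg_comp. Qed.

Lemma norm_cvg_in (x : nat -> X) (l : X) :
  coarser_than_norm sigma -> x @ \oo --> l -> cvg_in sigma x l.
Proof.
move=> coarse xl A; rewrite nbhsE => -[B [oB Bl] BA].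
have oB' : open (B : set X) by exact: coarse.
have /xl : nbhs l (B : set X) by exact: open_nbhs_nbhs.
by apply: filterS => k; exact: BA.
Qed.

Lemma closed_in_cvg_in (A : set X) (x : nat -> X) (l : X) :
  closed_in sigma A -> (\forall k \near \oo, A (x k)) -> cvg_in sigma x l ->
  A l.
Proof. by move=> cA Ax xl; exact: (@closed_cvg _ (with_topology sigma) _ _ x A cA Ax l xl).
Qed.

Lemma seq_compact_in_closed_ball (c : R) : scaling_continuous_in sigma ->
  seq_compact_in sigma [set x : X | `|x| <= 1] -> 0 < c ->
  seq_compact_in sigma [set x : X | `|x| <= c].
Proof.
move=> scal comp c0 x xc.
have cx1 n : `|c^-1 *: x n| <= 1.
  by rewrite normrZ gtr0_norm ?invr_gt0// ler_pdivrMl// mulr1; exact: xc.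
have [phi [l [phi_incr l1 xl]]] := comp _ cx1.
exists phi, (c *: l); split => //=.
  by rewrite normrZ gtr0_norm// -[leRHS]mulr1 ler_pM2l.
have cxl := continuous_cvg _ (scal c c0 l) xl.
suff -> : x \o phi = fun k => c *: (c^-1 *: x (phi k)) by exact: cxl.
by apply/funext => k; rewrite /= scalerA divff ?gt_eqF// scale1r.
Qed.

(** The definition asks every term to lie in A, but a limit does not see
    finitely many terms. *)
Lemma asymptotic_cone_near (A : set X) (t : nat -> R) (x : nat -> X) (u : X) :
  t @ \oo --> +oo -> (\forall k \near \oo, A (x k)) ->
  cvg_in sigma (fun k => (t k)^-1 *: x k) u -> asymptotic_cone sigma A u.
Proof.
move=> ty [N _ NA] xu; exists (t \o addn^~ N), (x \o addn^~ N).
have addN : addn^~ N @ \oo --> \oo.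
  by apply: increasing_cvgny => i j ij; rewrite ltn_add2r.
split; [exact: cvg_comp ty | by move=> k; apply: NA; exact: leq_addl |].
exact: cvg_in_subseq addN xu.
Qed.

Lemma asymptotic_cone0 (A : set X) :
  coarser_than_norm sigma -> A !=set0 -> asymptotic_cone sigma A 0.
Proof.
move=> coarse [a Aa]; exists (fun k => k.+1%:R), (fun=> a); split => //.
- by apply/cvgryPge => r; near do rewrite -natr1 ler_wpDr//; exact: nbhs_infty_ger.
- apply: norm_cvg_in => //; rewrite -[X in _ --> X](scale0r a).
  by apply: cvgZr_tmp; exact: cvg_harmonic.
Unshelve. all: by end_near. Qed.

(** For fixed y, almost all x k lie in the sublevel set of - psi(., y) at
    height 0, so 0 itself is one of the levels over which the infimum defining
    the asymptotic function at u is taken. *)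
Lemma recession_set_asymptotic (K : set X) (psi : X -> X -> R)
    (t : nat -> R) (x : nat -> X) (u : X) :
  t @ \oo --> +oo -> (forall k, K (x k)) ->
  (forall y, K y -> \forall k \near \oo, 0 <= psi (x k) y) ->
  cvg_in sigma (fun k => (t k)^-1 *: x k) u -> recession_set sigma K psi u.
Proof.
move=> ty Kx psi0 xu; split; first by exists t, x.
move=> y Ky; apply: ereal_inf_lbound; exists 0 => //=.
apply: asymptotic_cone_near ty _ xu.
apply: filterS (psi0 y Ky) => k psik.
by rewrite /sublevel /= /extend_pinfty mem_set// lee_fin oppr_le0.
Qed.

(** Once n exceeds the bound c, the w k of large index belong to K_n and so
    solve the problem there; this is what makes closedness of the solution sets
    on truncations applicable. Nonnegativity has to hold eventually uniformly in
    y over K_n, since psi(., y) carries no continuity of its own. *)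
Lemma equilibria_of_bounded_approx (K : set X) (psi : X -> X -> R)
    (w : nat -> X) (c : R) :
  scaling_continuous_in sigma ->
  seq_compact_in sigma [set x : X | `|x| <= 1] ->
  (forall n : nat, (0 < n)%N ->
     closed_in sigma (equilibria psi (truncation K n))) ->
  0 < c -> (forall k, K (w k) /\ `|w k| <= c) ->
  (forall n : nat, \forall k \near \oo, forall y, truncation K n y ->
     0 <= psi (w k) y) ->
  equilibria psi K !=set0.
Proof.
move=> scal comp Sclosed c0 Kw approx.
have [phi [l [phi_incr _ wl]]] :=
  seq_compact_in_closed_ball scal comp c0 (fun k => (Kw k).2).
have Sl (n : nat) : (0 < n)%N -> c <= n%:R ->
    equilibria psi (truncation K n) l.
  move=> n0 cn; apply: closed_in_cvg_in (Sclosed n n0) _ wl.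
  have : \forall k \near \oo, forall y, truncation K n y ->
      0 <= psi (w (phi k)) y := increasing_cvgny phi_incr (approx n).
  apply: filterS => k /= psik.
  by split => //; split; [exact: (Kw _).1 | exact: le_trans (Kw _).2 cn].
have Struncl (r : R) : exists n : nat,
    r <= n%:R /\ equilibria psi (truncation K n) l.
  exists (Num.truncn (Num.max c r)).+1.
  have := truncnS_gt (Num.max c r); rewrite gt_max => /andP[cn rn].
  by split; [exact: ltW | exact: Sl (ltW cn)].
exists l; split=> [|y Ky]; first by have [n [_ [[]]]] := Struncl 0.
by have [n [yn [_]]] := Struncl `|y|; apply.
Qed.

End TopologyOnNormedSpace.

Theorem theorem2 (R : realType) (X : normedModType R) (sigma : topology_on X)
  (sigma_hausdorff : hausdorff_in sigma)
  (sigma_coarser : coarser_than_norm sigma)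
  (sigma_scaling : scaling_continuous_in sigma)
  (ball_compact : seq_compact_in sigma [set x : X | `|x| <= 1])
  (K : set X) (K_nonempty : K !=set0) (K_closed : closed_in sigma K)
  (psi : X -> X -> R)
  (psi_K : condition_K sigma K psi)
  (S_nonempty : forall n : nat, (0 < n)%N ->
     equilibria psi (truncation K n) !=set0)
  (S_closed : forall n : nat, (0 < n)%N ->
     closed_in sigma (equilibria psi (truncation K n)))
  (R_trivial : recession_set sigma K psi `<=` [set 0]) :
  equilibria psi K !=set0 /\
  asymptotic_cone sigma (equilibria psi K) = [set 0].
Proof.
have S_neq0 : equilibria psi K !=set0.
  have truncS (m n : nat) y :
      (m <= n)%N -> truncation K m y -> truncation K n y.
    by move=> mn [Ky ym]; split => //=; apply: le_trans ym _; rewrite ler_nat.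
  have /choice[x Sx] (n : nat) :
      exists a, (0 < n)%N -> equilibria psi (truncation K n) a.
    case: n => [|n]; first by exists 0.
    by have [a Sa] := S_nonempty n.+1 isT; exists a.
  have [xbnd|xunbnd] := pselect (bounded_set (range x)).
    have [c c0 xc] := pinfty_ex_gt0 xbnd.
    (* The choice of x leaves x 0 arbitrary, possibly outside K: shift by one. *)
    apply: (equilibria_of_bounded_approx (w := x \o S) sigma_scaling
      ball_compact S_closed c0).
      move=> k; have [[Kx _] _] := Sx k.+1 isT.
      by split => //; apply: xc; exists k.+1.
    move=> n; exists n => // k /= nk y Ky.
    by apply: (Sx k.+1 isT).2; apply: truncS Ky; exact: leqW.
  have [phi [w [d [[phi_incr phi0] Kw [_ d0] psiw wd]]]] := psi_K x Sx xunbnd.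
  have approx (n : nat) : \forall k \near \oo, forall y, truncation K n y ->
      0 <= psi (w k) y.
    have : \forall k \near \oo, (n <= phi k)%N :=
      increasing_cvgny phi_incr (nbhs_infty_ge n).
    apply: filterS => k nk y /(truncS _ _ _ nk) Ky.
    exact: le_trans ((Sx _ (phi0 k)).2 _ Ky) (psiw _ _ Ky).
  have [wy|] := pselect ((fun k => `|w k|) @ \oo --> +oo).
    (* Here d would be a nonzero recession direction. *)
    have /R_trivial : recession_set sigma K psi d; last by move/eqP: d0.
    apply: recession_set_asymptotic wy (fun k => (Kw k).1) _ wd => y Ky.
    apply: filterS (approx (Num.truncn `|y|).+1) => k; apply.
    by split => //=; exact/ltW/truncnS_gt.
  (* Otherwise infinitely many w k lie in one ball; g enumerates some. *)
  move=> wNy; have [c wc] : exists c, forall N, exists k,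
      (N <= k)%N /\ `|w k| <= c.
    apply: contrapT => Nc; apply: wNy; apply/cvgryPge => c.
    apply: contrapT => Nnear; apply: Nc; exists c => N.
    apply: contrapT => Nk; apply: Nnear; exists N => // k /= Nlek.
    by rewrite leNgt; apply/negP => /ltW wkc; apply: Nk; exists k.
  have /choice[g gP] := wc.
  have g_oo : g @ \oo --> \oo.
    move=> A [N _ NA]; exists N => // k /= Nk; apply: NA => /=.
    exact: leq_trans Nk (gP k).1.
  apply: (equilibria_of_bounded_approx (w := w \o g) (c := Num.max 1 c)
    sigma_scaling ball_compact S_closed).
  - by rewrite lt_max ltr01.
  - move=> k; split; first exact: (Kw _).1.
    by rewrite le_max (gP k).2 orbT.
  - by move=> n; exact: g_oo (approx n).
split => //; apply/seteqP; split => [u [t [x [ty Sx xu]]]|_ ->].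
  apply: R_trivial; apply: recession_set_asymptotic ty _ _ xu => [k|y Ky].
    exact: (Sx k).1.
  by apply: nearW => k; exact: (Sx k).2.
exact: asymptotic_cone0.
Qed.
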